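(* Let $\mathcal{H}_A,\mathcal{H}_B$ be complex Hilbert spaces of finite dimensions $d_A,d_B$, and let $d=d_Ad_B\ge 2$. (a) Let $p_1,p_2,p_3$ be real numbers. There exists a separable state $\rho_{AB}$ on $\mathcal{H}_A\otimes\mathcal{H}_B$ such that $p_k=\operatorname{Tr}[(\rho_{AB}^{T_A})^k]$ for $k=1,2,3$ if and only if $$p_1=1,\qquad \frac1d\le p_2\le 1,$$ $$p_3\le [1-(d-1)y]^3+(d-1)y^3,$$ $$p_3\ge \alpha x^3+(1-\alpha x)^3,$$ where $$\alpha=\Big\lfloor\frac{1}{p_2}\Big\rfloor,\qquad x=\frac{\alpha+\sqrt{\alpha[p_2(\alpha+1)-1]}}{\alpha(\alpha+1)},\qquad y=\frac{d-1-\sqrt{(d-1)(p_2d-1)}}{d(d-1)}.$$ (b) Suppose that $p_k=\operatorname{Tr}[(\rho^{T_A})^k]$, $k=1,2,3$, for some quantum state $\rho$ (separable or entangled) on $\mathcal{H}_A\otimes\mathcal{H}_B$. Then there exists a separable state $\rho_{AB}$ on $\mathcal{H}_A\otimes\mathcal{H}_B$ with $p_k=\operatorname{Tr}[(\rho_{AB}^{T_A})^k]$ for $k=1,2,3$ if and only if $$p_3\ge\alpha x^3+(1-\alpha x)^3,$$ where $\alpha=\lfloor 1/p_2\rfloor$ and $x=\frac{\alpha+\sqrt{\alpha[p_2(\alpha+1)-1]}}{\alpha(\alpha+1)}$.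
   Context: A quantum state on $\mathcal{H}_A\otimes\mathcal{H}_B$ is a positive semidefinite operator of trace one. It is separable if it is a convex combination of product states $\sigma_A\otimes\sigma_B$ (with $\sigma_A$, $\sigma_B$ quantum states on $\mathcal{H}_A$, $\mathcal{H}_B$), and entangled otherwise. $\rho^{T_A}$ denotes the partial transpose on $\mathcal{H}_A$ with respect to a fixed orthonormal basis, i.e. the linear map determined by $(X\otimes Y)^{T_A}=X^T\otimes Y$. The numbers $\operatorname{Tr}[(\rho^{T_A})^k]$ are called the PT-moments of $\rho$. *)

(* Defs.v *)
From mathcomp Require Import all_boot all_order all_algebra.
From mathcomp Require Import reals.
From mathcomp Require Export complex mxtens.

Set Implicit Arguments.
Unset Strict Implicit.
Unset Printing Implicit Defensive.

Import Order.TTheory GRing.Theory Num.Theory.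
Local Open Scope ring_scope.
Local Open Scope complex_scope.
Local Open Scope sesquilinear_scope.

(* A d-dimensional complex Hilbert space is C^d with its standard orthonormal
   basis, so its operators are d x d matrices; H_A (x) H_B is C^(dA * dB) with
   the product basis, and X (x) Y is the Kronecker product X *t Y. *)

Definition psd (R : realType) (n : nat) (A : 'M[R[i]]_n) : Prop :=
  A \is hermsymmx /\ forall v : 'cV[R[i]]_n, 0 <= (v ^t* *m A *m v) 0 0.

Definition quantum_state (R : realType) (n : nat) (rho : 'M[R[i]]_n) : Prop :=
  psd rho /\ \tr rho = 1.

Definition separable_state (R : realType) (dA dB : nat)
    (rho : 'M[R[i]]_(dA * dB)) : Prop :=
  quantum_state rho /\
  exists (m : nat) (w : 'I_m -> R)
         (sA : 'I_m -> 'M[R[i]]_dA) (sB : 'I_m -> 'M[R[i]]_dB),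
    [/\ forall k, 0 <= w k,
        \sum_(k < m) w k = 1,
        forall k, quantum_state (sA k),
        forall k, quantum_state (sB k)
      & rho = \sum_(k < m) (w k)%:C *: (sA k *t sB k)].

(* mxtens_unindex splits a product-basis index into its pair (A, B); only the
   A-components of the row and column indices are exchanged. *)
Definition ptransposeA (R : realType) (dA dB : nat)
    (M : 'M[R[i]]_(dA * dB)) : 'M[R[i]]_(dA * dB) :=
  \matrix_(i, j) M (mxtens_index ((mxtens_unindex j).1, (mxtens_unindex i).2))
                   (mxtens_index ((mxtens_unindex i).1, (mxtens_unindex j).2)).

Lemma ptransposeA_linear (R : realType) (dA dB : nat) :
  linear (@ptransposeA R dA dB).
Proof. by move=> a M N; apply/matrixP=> i j; rewrite !mxE. Qed.

Lemma ptransposeA_tens (R : realType) (dA dB : nat)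
    (X : 'M[R[i]]_dA) (Y : 'M[R[i]]_dB) :
  ptransposeA (X *t Y) = X^T *t Y.
Proof. by apply/matrixP=> i j; rewrite !mxE !mxtens_indexK. Qed.

Lemma ptransposeA_unique (R : realType) (dA dB : nat)
    (f : {linear 'M[R[i]]_(dA * dB) -> 'M[R[i]]_(dA * dB)}) :
  (forall (X : 'M_dA) (Y : 'M_dB), f (X *t Y) = X^T *t Y) ->
  f =1 @ptransposeA R dA dB.
Proof.
move=> fT M.
have deltaT (i j : 'I_(dA * dB)) : delta_mx i j =
    delta_mx (mxtens_unindex i).1 (mxtens_unindex j).1 *t
    delta_mx (mxtens_unindex i).2 (mxtens_unindex j).2 :> 'M[R[i]]_(dA * dB).
  apply/matrixP=> k l; rewrite !mxE -natrM mulnb andbACA.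
  have E a b : (a == b :> 'I_(dA * dB)) =
      ((mxtens_unindex a).1 == (mxtens_unindex b).1) &&
      ((mxtens_unindex a).2 == (mxtens_unindex b).2).
    by rewrite -(can_eq (@mxtens_unindexK dA dB)).
  by rewrite -!E.
pose g := @ptransposeA R dA dB.
have gD : {morph g : A B / A + B} by move=> A B; apply/matrixP=> i j; rewrite !mxE.
have g0 : g 0 = 0 by apply/matrixP=> i j; rewrite !mxE.
have gZ a A : g (a *: A) = a *: g A by apply/matrixP=> i j; rewrite !mxE.
rewrite -/g [M]matrix_sum_delta linear_sum (big_morph g gD g0).
apply: eq_bigr => i _; rewrite linear_sum (big_morph g gD g0).
apply: eq_bigr => j _; rewrite linearZ gZ /= /g deltaT fT.
by rewrite ptransposeA_tens.
Qed.

(* 'M_n is a ring for every n : nat, so ^+ is the matrix power. *)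
Definition pt_moment (R : realType) (dA dB : nat)
    (rho : 'M[R[i]]_(dA * dB)) (k : nat) : R[i] :=
  \tr (ptransposeA rho ^+ k).

(* The PT-moment is a complex number; the condition forces it to be real. *)
Definition has_pt_moments (R : realType) (dA dB : nat)
    (rho : 'M[R[i]]_(dA * dB)) (p1 p2 p3 : R) : Prop :=
  [/\ p1%:C = pt_moment rho 1,
      p2%:C = pt_moment rho 2
    & p3%:C = pt_moment rho 3].

Definition alpha (R : realType) (p2 : R) : R := (Num.floor (1 / p2))%:~R.

Definition xpt (R : realType) (p2 : R) : R :=
  let a := alpha p2 in
  (a + Num.sqrt (a * (p2 * (a + 1) - 1))) / (a * (a + 1)).

Definition ypt (R : realType) (d : nat) (p2 : R) : R :=
  (d%:R - 1 - Num.sqrt ((d%:R - 1) * (p2 * d%:R - 1))) / (d%:R * (d%:R - 1)).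

(* Main.v *)
(* The partial transpose of a separable state is positive semidefinite of trace
   one, so its spectrum is a probability vector of length d; conversely every
   probability vector is the spectrum of a diagonal, hence separable and
   transpose-invariant, state.  The theorem thus describes the values of
   (sum l_i^2, sum l_i^3) over probability vectors l.  For fixed sum of squares
   the cubes are largest at (a, y, ..., y) with a = 1 - (d - 1) y, also among
   real vectors with entries of any sign, and smallest at
   (x, ..., x, 1 - alpha x, 0, ..., 0); an explicit arc in the level set joins
   these two extremal vectors.  For (b), the partial transpose preserves
   Hermiticity, trace and purity, so an arbitrary state already satisfies every
   condition except the lower bound. *)

Require Import Defs.
From mathcomp Require Import all_boot all_order all_algebra.
From mathcomp Require Import reals.
From mathcomp Require Import ring lra.
Import Order.TTheory GRing.Theory Num.Theory.
Local Open Scope ring_scope.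

(** * The largest sum of cubes of a real vector *)

Section PowerSums.
Variable R : realType.

Lemma sum_expr1 (I : finType) (l : I -> R) : \sum_i l i ^+ 1 = \sum_i l i.
Proof. by apply: eq_bigr => i _; rewrite expr1. Qed.

Lemma sum_cubic (I : Type) (r : seq I) (l : I -> R) (c3 c2 c1 c0 : R) :
  \sum_(i <- r) (c3 * l i ^+ 3 + c2 * l i ^+ 2 + c1 * l i + c0) =
  c3 * (\sum_(i <- r) l i ^+ 3) + c2 * (\sum_(i <- r) l i ^+ 2)
    + c1 * (\sum_(i <- r) l i) + \sum_(i <- r) c0.
Proof. by rewrite !big_split /= -!mulr_sumr. Qed.

Lemma sum_sqr_sub (I : finType) (l m : I -> R) :
  \sum_i (l i - m i) ^+ 2 =
  \sum_i l i ^+ 2 + \sum_i m i ^+ 2 - 2 * (\sum_i l i * m i).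
Proof.
rewrite mulr_sumr -big_split -sumrB /=; apply: eq_bigr => i _; ring.
Qed.

Lemma sum_sqr_eq0 (I : finType) (l : I -> R) :
  \sum_i l i ^+ 2 <= 0 -> forall i, l i = 0.
Proof.
move=> l0 i; apply/eqP; rewrite -sqrf_eq0 eq_le sqr_ge0 andbT.
apply: le_trans l0; rewrite (bigD1 i) //= lerDl.
by apply: sumr_ge0 => j _; exact: sqr_ge0.
Qed.

(* Equality holds at [(a, y, ..., y)], so summing [(a - t) (t - y)^2 >= 0] over
   the entries gives the bound as soon as no entry exceeds [a]. *)
Lemma sum_cube_le n (l : 'I_n -> R) (a y : R) :
  y <= a -> a + (n%:R - 1) * y = 1 ->
  \sum_i l i = 1 -> \sum_i l i ^+ 2 = a ^+ 2 + (n%:R - 1) * y ^+ 2 ->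
  \sum_i l i ^+ 3 <= a ^+ 3 + (n%:R - 1) * y ^+ 3.
Proof.
move=> ya ay1 l1 l2.
(* The squared distances of the entries to [y] add up to [(a - y)^2], which an entry above [a] would
   exceed by itself. *)
have la i : l i <= a.
  rewrite leNgt; apply/negP => ali.
  have : 0 <= \sum_(j | j != i) (l j - y) ^+ 2.
    by apply: sumr_ge0 => j _; exact: sqr_ge0.
  have -> : \sum_(j | j != i) (l j - y) ^+ 2 =
      \sum_j (l j - y) ^+ 2 - (l i - y) ^+ 2.
    by rewrite [in RHS](bigD1 i) //= addrAC subrr add0r.
  have -> : \sum_j (l j - y) ^+ 2 =
      \sum_j (0 * l j ^+ 3 + 1 * l j ^+ 2 + (- 2 * y) * l j + y ^+ 2).
    by apply: eq_bigr => j _; ring.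
  rewrite sum_cubic l1 l2 sumr_const card_ord -mulr_natr => H.
  have : (l i - a) * (l i + a - 2 * y) <= 0 by nra.
  by apply/negP; rewrite -ltNge; nra.
have : 0 <= \sum_i (a - l i) * (l i - y) ^+ 2.
  by apply: sumr_ge0 => i _; rewrite mulr_ge0 ?sqr_ge0 // subr_ge0.
have -> : \sum_i (a - l i) * (l i - y) ^+ 2 =
   \sum_i (- 1 * l i ^+ 3 + (a + 2 * y) * l i ^+ 2
     + (- (2 * a * y + y ^+ 2)) * l i + a * y ^+ 2).
  by apply: eq_bigr => i _; ring.
rewrite sum_cubic l1 l2 sumr_const card_ord -mulr_natr => H.
have E := congr1 (fun v => (2 * a * y + y ^+ 2) * v) ay1.
by move: H E => /= H E; lra.
Qed.

(** * The smallest sum of cubes of a nonnegative vector *)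

Lemma sum_ge_const (r : seq R) (G : R -> R) (c : R) :
  {in r, forall t, c <= G t} -> (size r)%:R * c <= \sum_(t <- r) G t.
Proof.
move=> H; have -> : (size r)%:R * c = \sum_(t <- r) c.
  by rewrite big_const_seq count_predT iter_addr_0 mulr_natl.
by rewrite big_seq [leRHS]big_seq; apply: ler_sum => t /H.
Qed.

(* The competitor is [x] repeated [n = (size r).+1] times followed by [z].  A
   cubic [G] increasing on [0, w], decreasing on [w, x] and increasing after
   [x], with [w = u] or [w = t] according as [z <= t] or not, compares the two
   sorted lists term by term. *)
Lemma sum_cube_ge (r q : seq R) (u t x z : R) (n := (size r).+1%:R) :
  {in r, forall v, u <= v} -> t <= u -> {in q, forall v, 0 <= v <= t} ->
  0 <= t -> 0 <= z <= x ->
  let p k := \sum_(v <- r) v ^+ k + u ^+ k + t ^+ k + \sum_(v <- q) v ^+ k in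
  p 1 = n * x + z -> p 2 = n * x ^+ 2 + z ^+ 2 ->
  n * x ^+ 3 + z ^+ 3 <= p 3.
Proof.
move=> ru tu qt t0 /andP[z0 zx] p p1 p2.
(* The derivative in [v] is [6 (v - w) (v - x)], and [G w 0 = 0]. *)
pose G (w v : R) := 2 * v ^+ 3 + (- 3 * (w + x)) * v ^+ 2 + 6 * w * x * v.
have Gx w v : w <= v -> w <= x -> G w x <= G w v.
  move=> wv wx; rewrite -subr_ge0.
  have -> : G w v - G w x = (v - x) ^+ 2 * (2 * v + x - 3 * w).
    by rewrite /G; ring.
  by apply: mulr_ge0; [exact: sqr_ge0 | lra].
have Gup w v v' : v <= v' -> v' <= w -> w <= x -> 0 <= v -> G w v <= G w v'.
  move=> vv' v'w wx v0; rewrite -subr_ge0.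
  have -> : G w v' - G w v = (v' - v) *
     (6 * (w - v') * (x - v') + 3 * (v' - v) * (w + x - 2 * v')
       + 2 * (v' - v) ^+ 2) by rewrite /G; ring.
  apply: mulr_ge0; first lra.
  by rewrite !addr_ge0 ?mulr_ge0 ?sqr_ge0 //; lra.
have Gdown w v : w <= v -> v <= x -> G w v <= G w w.
  move=> wv vx; rewrite -subr_ge0.
  have -> : G w w - G w v = (v - w) ^+ 2 *
     (3 * (x - v) + (v - w)) by rewrite /G; ring.
  by apply: mulr_ge0; [exact: sqr_ge0 | lra].
(* Both lists have the same sum and sum of squares, so comparing the sums of [G w] amounts to
   comparing the sums of cubes. *)
suff [w H] : exists w, n * G w x + G w z <=
    \sum_(v <- r) G w v + G w u + G w t + \sum_(v <- q) G w v.
  have sG l : \sum_(v <- l) G w v = 2 * (\sum_(v <- l) v ^+ 3) +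
      (- 3 * (w + x)) * (\sum_(v <- l) v ^+ 2) + 6 * w * x * (\sum_(v <- l) v).
    rewrite (eq_bigr (fun v => 2 * v ^+ 3 + (- 3 * (w + x)) * v ^+ 2
      + 6 * w * x * v + 0)); last by move=> v _; rewrite addr0.
    by rewrite (sum_cubic _ _ (fun v => v)) big1_eq addr0.
  rewrite !sG in H.
  move: p1 p2; rewrite /p => p1 p2.
  have E1 := congr1 (fun v => 6 * w * x * v) p1.
  have E2 := congr1 (fun v => - 3 * (w + x) * v) p2.
  have e1 l : \sum_(v <- l) v ^+ 1 = \sum_(v <- l) v :> R.
    by apply: eq_bigr => v _; rewrite expr1.
  by move: H E1 E2; rewrite /G !e1 => *; lra.
have nE : n = (size r)%:R + 1 by rewrite /n -natr1.
case: (lerP z t) => zt.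
(* Otherwise [u] exceeds [x], as do all entries of [r], while [z <= t], and the total sum is too
   large. *)
- have ux : u <= x.
    rewrite leNgt; apply/negP => xu.
    have H1 : (size r)%:R * x <= \sum_(v <- r) v ^+ 1.
      by apply: sum_ge_const => v /ru; rewrite expr1; lra.
    have H2 : 0 <= \sum_(v <- q) v ^+ 1.
      by rewrite big_seq; apply: sumr_ge0 => v /qt; rewrite expr1 => /andP[].
    by move: p1; rewrite /p nE !expr1; lra.
  exists u.
  have H1 : (size r)%:R * G u x <= \sum_(v <- r) G u v.
    by apply: sum_ge_const => v /ru uv; exact: Gx.
  have H2 : 0 <= \sum_(v <- q) G u v.
    rewrite big_seq; apply: sumr_ge0 => v /qt /andP[v0 vt].
    have -> : 0 = G u 0 by rewrite /G; ring.
    by apply: Gup => //; lra.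
  have := Gx u u (lexx _) ux; have := Gup u z t zt tu ux z0.
  by rewrite nE; lra.
- exists t; have tx : t <= x by lra.
  have H1 : (size r)%:R * G t x <= \sum_(v <- r) G t v.
    by apply: sum_ge_const => v /ru uv; apply: Gx => //; lra.
  have H2 : 0 <= \sum_(v <- q) G t v.
    rewrite big_seq; apply: sumr_ge0 => v /qt /andP[v0 vt].
    have -> : 0 = G t 0 by rewrite /G; ring.
    by apply: Gup => //; lra.
  have := Gx t u tu tx; have := Gdown t z (ltW zt) zx.
  by rewrite nE; lra.
Qed.

(** Sorting in decreasing order provides the lists of [sum_cube_ge]: the [m] largest entries face
    [x], the next one [z], the remaining ones zeros. *)
Lemma sum_cube_ge_ord n (l : 'I_n -> R) (m : nat) (x z : R) :
  (0 < m <= n)%N -> (forall i, 0 <= l i) -> 0 <= z <= x -> m%:R * x + z = 1 ->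
  \sum_i l i = 1 -> \sum_i l i ^+ 2 = m%:R * x ^+ 2 + z ^+ 2 ->
  m%:R * x ^+ 3 + z ^+ 3 <= \sum_i l i ^+ 3.
Proof.
move=> /andP[m0 mn] l0 zx xz1 l1 l2.
(* The extra zero provides an entry of rank [m.+1] when [m = n]. *)
pose s := sort (fun a b : R => b <= a) (rcons (codom l) 0).
have sP k : (0 < k)%N -> \sum_(v <- s) v ^+ k = \sum_i l i ^+ k.
  move=> k0; rewrite (perm_big (rcons (codom l) 0)) ?perm_sort //=.
  by rewrite -cats1 big_cat big_seq1 /= expr0n gtn_eqF // addr0 big_image.
have szs : size s = n.+1 by rewrite size_sort size_rcons size_codom card_ord.
have s0 : {in s, forall v, 0 <= v}.
  move=> v; rewrite mem_sort mem_rcons inE => /orP[/eqP -> //|].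
  by case/codomP => i ->.
have ss : sorted (fun a b : R => b <= a) s.
  by apply: sort_sorted => a b; exact: le_total.
have tr : transitive (fun a b : R => b <= a).
  by move=> a b c ba ac; apply: le_trans ac ba.
(* From here on [m] is one less than the number of copies of [x]. *)
case: m m0 mn xz1 l2 => // m _ mn xz1 l2.
clearbody s.
have rm : size (take m s) = m by rewrite size_take szs ltnS (ltnW mn).
have E : s = take m s ++ [:: nth 0 s m, nth 0 s m.+1 & drop m.+2 s].
  by rewrite -!drop_nth ?cat_take_drop ?szs // ltnW.
move: E rm; set r := take m s; set u := nth 0 s m; set t := nth 0 s m.+1.
set q := drop _ s; move: ss s0 sP; clearbody r u t q => ss s0 sP E rm; subst s.
have := @sum_cube_ge r q u t x z; rewrite rm /=.
have bigE k : \sum_(v <- r) v ^+ k + u ^+ k + t ^+ k + \sum_(v <- q) v ^+ k =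
   \sum_(v <- r ++ [:: u, t & q]) v ^+ k.
  by rewrite big_cat /= !big_cons !addrA.
rewrite !bigE !sP // => H.
move: ss; rewrite sorted_pairwise // pairwise_cat /=.
move=> /and5P[/allrelP ru _ /andP[tu uq] tq _].
apply: H => //.
- by move=> v vr; apply: ru => //; rewrite inE eqxx.
- move=> v vq; rewrite (allP tq) // andbT; apply: s0.
  by rewrite mem_cat !inE vq !orbT.
- by apply: s0; rewrite mem_cat !inE eqxx !orbT.
- by rewrite sum_expr1 l1 xz1.
Qed.

(** * Joining two points of a sphere inside the simplex *)

Lemma sum_sqr_linear (I : finType) (l m : I -> R) (s t : R) :
  \sum_i (s * l i + t * m i) ^+ 2 =
  s ^+ 2 * (\sum_i l i ^+ 2) + t ^+ 2 * (\sum_i m i ^+ 2)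
    + 2 * s * t * (\sum_i l i * m i).
Proof. by rewrite !mulr_sumr -!big_split; apply: eq_bigr => i _ /=; ring. Qed.

(* For [t] in [0, 1] let [q] be the second point where the line from [e] towards
   [(1 - t) f + t g] meets the sphere [sum_i q_i^2 = c].  It is [f] at [t = 0]
   and moves rationally in [t] until the line becomes tangent, when it is [e];
   it stays in the convex hull of [e], [f], [g] since [f] and [g] see the whole
   segment [f g] outside the ball. *)
Lemma sphere_ivt (I : finType) (e f g : I -> R) (c p3 : R) :
  (forall i, 0 <= e i) -> (forall i, 0 <= f i) -> (forall i, 0 <= g i) ->
  \sum_i e i = 1 -> \sum_i f i = 1 -> \sum_i g i = 1 ->
  \sum_i e i ^+ 2 = c -> \sum_i f i ^+ 2 = c -> c <= \sum_i g i ^+ 2 ->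
  c <= \sum_i e i * g i -> c <= \sum_i f i * g i ->
  \sum_i e i ^+ 3 <= p3 <= \sum_i f i ^+ 3 ->
  exists q : I -> R, [/\ forall i, 0 <= q i, \sum_i q i = 1,
    \sum_i q i ^+ 2 = c & \sum_i q i ^+ 3 = p3].
Proof.
move=> e0 f0 g0 e1 f1 g1 e2 f2 g2 eg fg /andP[].
rewrite le_eqVlt => /orP[/eqP <- _|ep fp]; first by exists e.
have neq_ef : ~ (forall i, e i = f i).
  move=> ef; have : \sum_i e i ^+ 3 = \sum_i f i ^+ 3.
    by apply: eq_bigr => i _; rewrite ef.
  lra.
have eqs (l m : I -> R) :
    \sum_i l i ^+ 2 + \sum_i m i ^+ 2 <= 2 * (\sum_i l i * m i) ->
    forall i, l i = m i.
  move=> H i; apply/eqP; rewrite -subr_eq0; apply/eqP; move: i.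
  by apply: sum_sqr_eq0; rewrite sum_sqr_sub subr_le0.
have ef : \sum_i e i * f i < c.
  by rewrite ltNge; apply/negP => H; apply: neq_ef; apply: eqs; lra.
(* If [g] lay on the sphere, equality in Cauchy-Schwarz would force [e = g = f]. *)
have {}g2 : c < \sum_i g i ^+ 2.
  rewrite lt_neqAle g2 andbT; apply/eqP => cg; apply: neq_ef => i.
  have [eg1 fg1] : e i = g i /\ f i = g i.
    by split; [apply: (eqs e g)|apply: (eqs f g)]; lra.
  by rewrite eg1.
(* The line from [e] in direction [v t] meets the sphere again at [e + s v t] with
   [s = - 2 B t / V t]. *)
pose w t i := (1 - t) * f i + t * g i.
pose v t i := w t i - e i.
pose V t := \sum_i v t i ^+ 2.
pose B t := \sum_i e i * v t i.
have w2 t : \sum_i w t i ^+ 2 = (1 - t) ^+ 2 * c + t ^+ 2 * (\sum_i g i ^+ 2)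
    + 2 * (1 - t) * t * (\sum_i f i * g i).
  by rewrite /w sum_sqr_linear f2.
have BE t : B t = (1 - t) * (\sum_i e i * f i) + t * (\sum_i e i * g i) - c.
  rewrite -e2 /B /v /w !mulr_sumr -sumrN -!big_split.
  by apply: eq_bigr => i _ /=; ring.
have VE t : V t = \sum_i w t i ^+ 2 - c - 2 * B t.
  rewrite /V /v sum_sqr_sub e2 /B /v.
  have -> : \sum_i e i * (w t i - e i) = \sum_i w t i * e i - c.
    by rewrite -e2 -sumrB; apply: eq_bigr => i _; ring.
  by ring.
(* The segment from [f] to [g] touches the ball only at [f]. *)
have w2c t : 0 <= t <= 1 -> c <= \sum_i w t i ^+ 2 ?= iff (t == 0).
  move=> /andP[t0 t1].
  have H1 : 0 <= (1 - t) * t * (\sum_i f i * g i - c).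
    by rewrite !mulr_ge0 //; lra.
  have H2 : 0 <= t ^+ 2 * (\sum_i g i ^+ 2 - c).
    by rewrite mulr_ge0 ?sqr_ge0 // subr_ge0 ltW.
  split; first by rewrite w2; lra.
  have [->|tn0] := eqVneq t 0; first by rewrite w2; apply/eqP; ring.
  apply/negbTE; rewrite neq_lt w2; apply/orP; left.
  have : 0 < t ^+ 2 * (\sum_i g i ^+ 2 - c).
    by rewrite mulr_gt0 ?subr_gt0 // exprn_even_gt0 //= tn0.
  by lra.
(* [w t = e] would put [w t] on the sphere, hence [t = 0] and [e = f]. *)
have V_gt0 t : 0 <= t <= 1 -> 0 < V t.
  move=> t01; rewrite lt_neqAle sumr_ge0 ?andbT => [|i _]; last exact: sqr_ge0.
  apply/eqP => V0.
  have ew i : w t i = e i.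
    apply/eqP; rewrite -subr_eq0; apply/eqP; move: i.
    by apply: sum_sqr_eq0; rewrite -/(V t) -V0.
  have wc : \sum_i w t i ^+ 2 = c.
    by rewrite -e2; apply: eq_bigr => i _; rewrite ew.
  have [_] := w2c t t01; rewrite wc eqxx => /esym/eqP tE.
  by apply: neq_ef => i; rewrite -ew tE /w; ring.
(* Multiplying by [V t ^+ 3] clears the denominators: [P] vanishes exactly when the cubes of the
   second point sum to [p3]. *)
have [P PE] : exists P : {poly R}, forall t,
    P.[t] = \sum_i (e i * V t - 2 * B t * v t i) ^+ 3 - p3 * V t ^+ 3.
  exists (\sum_i ((e i)%:P * (\sum_j ((f j - e j)%:P + (g j - f j) *: 'X) ^+ 2)
   - 2 *: (\sum_j (e j)%:P * ((f j - e j)%:P + (g j - f j) *: 'X))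
       * ((f i - e i)%:P + (g i - f i) *: 'X)) ^+ 3
   - p3 *: (\sum_j ((f j - e j)%:P + (g j - f j) *: 'X) ^+ 2) ^+ 3) => t.
  have vE j : ((f j - e j)%:P + (g j - f j) *: 'X).[t] = v t j.
    by rewrite !hornerE /v /w; ring.
  have vVE : (\sum_j ((f j - e j)%:P + (g j - f j) *: 'X) ^+ 2).[t] = V t.
    by rewrite horner_sum; apply: eq_bigr => j _; rewrite horner_exp vE.
  have vBE : (\sum_j (e j)%:P * ((f j - e j)%:P + (g j - f j) *: 'X)).[t] = B t.
    by rewrite horner_sum; apply: eq_bigr => j _; rewrite hornerM vE hornerC.
  rewrite hornerD hornerN hornerZ horner_exp vVE horner_sum; congr (_ - _).
  apply: eq_bigr => j _.
  by rewrite horner_exp hornerD hornerN !hornerM hornerZ vVE vBE vE hornerC.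
(* The zero of the affine function [B], where the line is tangent at [e]. *)
pose T := (c - \sum_i e i * f i) / (\sum_i e i * g i - \sum_i e i * f i).
have T01 : 0 <= T <= 1.
  by rewrite divr_ge0 ?ler_pdivrMr /= ?mul1r; lra.
have BT : B T = 0.
  by rewrite BE /T; field; rewrite gt_eqF //; lra.
have [t /andP[t0 tT] Pt] : exists2 t, 0 <= t <= T & root P t.
  (* [P] goes from nonnegative at 0 to nonpositive at [T], so [poly_ivt] is applied to [- P]. *)
  suff [t ? ?] : exists2 t, 0 <= t <= T & root (- P) t.
    by exists t; rewrite -1?rootN.
  apply: poly_ivt; first by case/andP: T01.
  rewrite !hornerN !PE BT oppr_le0 oppr_ge0; apply/andP; split.
    have V0E : V 0 = - 2 * B 0.
      by rewrite VE w2; ring.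
    have -> : \sum_i (e i * V 0 - 2 * B 0 * v 0 i) ^+ 3 =
        V 0 ^+ 3 * (\sum_i f i ^+ 3).
      rewrite [RHS]mulr_sumr; apply: eq_bigr => i _; rewrite V0E /v /w; ring.
    rewrite mulrC -mulrBl mulr_ge0 ?subr_ge0 //.
    by rewrite exprn_ge0 // ltW // V_gt0 // lexx ler01.
  have -> : \sum_i (e i * V T - 2 * 0 * v T i) ^+ 3 =
      V T ^+ 3 * (\sum_i e i ^+ 3).
    by rewrite [RHS]mulr_sumr; apply: eq_bigr => i _; ring.
  rewrite mulrC -mulrBl pmulr_lle0 ?exprn_gt0 ?V_gt0 // subr_le0; exact: ltW.
have t01 : 0 <= t <= 1 by rewrite t0 (le_trans tT) //; case/andP: T01.
have Vt := V_gt0 t t01.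
pose s := - 2 * B t / V t.
have Bt : B t <= 0.
  have : t * (\sum_i e i * g i - \sum_i e i * f i) <= c - \sum_i e i * f i.
    by rewrite -ler_pdivlMr //; lra.
  by rewrite BE; lra.
(* The bound [s <= 1] amounts to [c <= \sum_i w t i ^+ 2]; it keeps the point between [e] and [w t],
   hence nonnegative. *)
have s01 : 0 <= s <= 1.
  have B0 : 0 <= - 2 * B t by lra.
  rewrite divr_ge0 ?(ltW Vt) //= ler_pdivrMr // mul1r VE.
  by have [H _] := w2c t t01; lra.
have sV : s * V t = - 2 * B t by rewrite divfK // gt_eqF.
exists (fun i => e i + s * v t i); split.
- move=> i; have -> : e i + s * v t i = (1 - s) * e i + s * w t i.
    by rewrite /v; ring.
  have wi : 0 <= w t i.
    by case/andP: t01 => *; apply: addr_ge0; apply: mulr_ge0; rewrite ?subr_ge0.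
  by case/andP: s01 => *; apply: addr_ge0; apply: mulr_ge0; rewrite ?subr_ge0.
- rewrite big_split /= -mulr_sumr e1 sumrB e1 /w big_split /= -!mulr_sumr f1 g1.
  ring.
- rewrite (eq_bigr (fun i => (1 * e i + s * v t i) ^+ 2)) ; last first.
    by move=> i _; rewrite mul1r.
  rewrite sum_sqr_linear e2 -/(V t) -/(B t) expr2 -[s * s * _]mulrA sV; ring.
- apply: (mulIf (_ : V t ^+ 3 != 0)); first by rewrite expf_neq0 ?gt_eqF.
  move/rootP: Pt; rewrite PE => /subr0_eq <-; rewrite mulr_suml.
  apply: eq_bigr => i _; rewrite -exprMn; congr (_ ^+ 3).
  by rewrite mulrDl mulrAC sV; ring.
Qed.

(** * The extremal vectors as functions of [p2] *)

(** [y] is the smaller root of [(1 - (n - 1) y)^2 + (n - 1) y^2 = p2]; it is nonnegative because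
    [p2 <= 1]. *)
Lemma ypt_spec n (p2 : R) (y := ypt n p2) (a := 1 - (n%:R - 1) * y) :
  (2 <= n)%N -> 1 / n%:R <= p2 <= 1 ->
  [/\ 0 <= y, y <= a & a ^+ 2 + (n%:R - 1) * y ^+ 2 = p2].
Proof.
move=> n2 /andP[lp pu].
have n2R : 2 <= n%:R :> R by rewrite ler_nat.
have np : 1 <= p2 * n%:R by rewrite -ler_pdivrMr //; lra.
have S2 : Num.sqrt ((n%:R - 1) * (p2 * n%:R - 1)) ^+ 2 =
    (n%:R - 1) * (p2 * n%:R - 1).
  by rewrite sqr_sqrtr // mulr_ge0 //; lra.
have S0 := sqrtr_ge0 ((n%:R - 1) * (p2 * n%:R - 1)).
move: S2 S0; rewrite /a /y /ypt.
set S := Num.sqrt _; set N := n%:R in n2R np *; move=> S2 S0.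
have SN : S <= N - 1.
  rewrite -(ler_pXn2r (ltn0Sn 1)) ?nnegrE //; [|lra].
  rewrite S2 expr2 ler_wpM2l //; first lra.
  by rewrite lerD2r ler_piMl //; lra.
have Nn0 : N != 0 by rewrite gt_eqF //; lra.
have N1n0 : N - 1 != 0 by rewrite gt_eqF //; lra.
split.
- by rewrite divr_ge0 ?mulr_ge0 //; lra.
- rewrite -subr_ge0.
  have -> : 1 - (N - 1) * ((N - 1 - S) / (N * (N - 1)))
      - (N - 1 - S) / (N * (N - 1)) = S / (N - 1) by field; apply/andP.
  by rewrite divr_ge0 //; lra.
- have pE : p2 = (S ^+ 2 / (N - 1) + 1) / N by rewrite S2; field; apply/andP.
  by rewrite pE; field; apply/andP.
Qed.

(** [x] is the larger root of [alpha x^2 + (1 - alpha x)^2 = p2]. In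
    [alpha p2 <= 1 < (alpha + 1) p2], the right inequality makes the discriminant positive and the
    left one gives [0 <= z]. If [m = n], then [p2 = 1 / n] and [z] vanishes. *)
Lemma xpt_spec n (p2 : R) (x := xpt p2) (z := 1 - alpha p2 * x) :
  (0 < n)%N -> 1 / n%:R <= p2 <= 1 ->
  exists m : nat, [/\ (0 < m <= n)%N, alpha p2 = m%:R, 0 <= z <= x,
    m%:R * x ^+ 2 + z ^+ 2 = p2 & m = n -> z = 0].
Proof.
move=> n0 /andP[lp pu].
have n0R : 0 < n%:R :> R by rewrite ltr0n.
have p0 : 0 < p2 by apply: lt_le_trans lp; rewrite divr_gt0.
have lo : 0 < Num.floor (1 / p2) by rewrite floor_gt0 ler_pdivlMr // mul1r.
have hi : Num.floor (1 / p2) <= n%:Z.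
  rewrite -(ler_int R); apply: le_trans (floor_le _) _.
  by rewrite ler_pdivrMr // mulrC -ler_pdivrMr.
have := floor_itv (1 / p2).
have aE : alpha p2 = (Num.floor (1 / p2))%:~R by [].
move: lo hi aE; case: (Num.floor (1 / p2)) => // m m1 mn aE /andP[fl fu].
have {}aE : alpha p2 = m%:R by [].
have {m1 mn} [m1 mn] : (0 < m)%N /\ (m <= n)%N by [].
have {}fl : m%:R * p2 <= 1 by rewrite -ler_pdivlMr.
have {}fu : 1 < (m%:R + 1) * p2 by rewrite -ltr_pdivrMr // natr1 -[m.+1]addn1.
have A1 : 1 <= m%:R :> R by rewrite ler1n.
have mn_p : m = n -> m%:R * p2 = 1.
  by move=> mnE; apply/le_anti; rewrite fl mnE mulrC -ler_pdivrMr.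
exists m; rewrite m1 mn /z /x /xpt aE.
move: A1 fl fu mn_p; set A := m%:R => A1 fl fu mn_p.
have S2 : Num.sqrt (A * (p2 * (A + 1) - 1)) ^+ 2 = A * (p2 * (A + 1) - 1).
  by rewrite sqr_sqrtr // mulr_ge0 //; lra.
have := sqrtr_ge0 (A * (p2 * (A + 1) - 1)).
move: S2; set S := Num.sqrt _ => S2 S0.
have A0 : A != 0 by rewrite gt_eqF //; lra.
have A10 : A + 1 != 0 by rewrite gt_eqF //; lra.
split => //.
- have S1 : S <= 1.
    rewrite -(ler_pXn2r (ltn0Sn 1)) ?nnegrE // S2 expr1n.
    have : 0 <= (A + 1) * (1 - A * p2) by rewrite mulr_ge0 //; lra.
    lra.
  have zE : 1 - A * ((A + S) / (A * (A + 1))) = (1 - S) / (A + 1).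
    by field; apply/andP.
  rewrite zE divr_ge0 /=; [|lra..].
  rewrite -subr_ge0.
  have -> : (A + S) / (A * (A + 1)) - (1 - S) / (A + 1) = S / A.
    by field; apply/andP.
  by rewrite divr_ge0 //; lra.
- have pE : p2 = (S ^+ 2 / A + 1) / (A + 1) by rewrite S2; field; apply/andP.
  by rewrite [RHS]pE; field; apply/andP.
- move=> /mn_p Ap.
  have S1 : S = 1.
    apply/eqP; rewrite -sqrp_eq1 // S2; apply/eqP.
    by have := congr1 (fun v => (A + 1) * v) Ap; rewrite /=; lra.
  by rewrite S1; field; apply/andP.
Qed.

(** For [m = n] no index is left to carry [z], whence the second hypothesis; the exponent is
    positive so that zero entries contribute nothing. *)
Lemma sum_step_ord n (m : nat) (x z : R) (k : nat) :
  (m <= n)%N -> (m = n -> z = 0) ->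
  \sum_(i < n) (if (i < m)%N then x else if i == m :> nat then z else 0) ^+ k.+1
  = m%:R * x ^+ k.+1 + z ^+ k.+1.
Proof.
move=> mn z0; rewrite -{z0}(subnKC mn) in z0 *.
rewrite big_split_ord /=; congr (_ + _).
  under eq_bigr do rewrite ltn_ord.
  by rewrite sumr_const card_ord mulr_natl.
case: (n - m)%N z0 => [|p] z0.
  by rewrite big_ord0 z0 ?addn0 // expr0n.
rewrite big_ord_recl /= addn0 ltnn eqxx big1 ?addr0 // => i _.
by rewrite ltnNge leq_addr /= -{2}[m]addn0 eqn_add2l expr0n.
Qed.

(** * Attainable sums of squares and cubes on the simplex *)

Lemma sum_sqr_ge n (l : 'I_n -> R) : (0 < n)%N ->
  \sum_i l i = 1 -> 1 / n%:R <= \sum_i l i ^+ 2.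
Proof.
move=> n0 l1; have nn0 : n%:R != 0 :> R by rewrite pnatr_eq0 -lt0n.
have : 0 <= \sum_i (l i - 1 / n%:R) ^+ 2.
  by apply: sumr_ge0 => i _; exact: sqr_ge0.
have -> : \sum_i (l i - 1 / n%:R) ^+ 2 = \sum_i l i ^+ 2 - 1 / n%:R.
  rewrite sum_sqr_sub -mulr_suml l1 sumr_const card_ord -mulr_natr.
  by field.
by rewrite subr_ge0.
Qed.

Lemma sum_sqr_le1 n (l : 'I_n -> R) : (forall i, 0 <= l i) ->
  \sum_i l i = 1 -> \sum_i l i ^+ 2 <= 1.
Proof.
move=> l0 l1; rewrite -[leRHS]l1; apply: ler_sum => i _.
rewrite expr2 ler_piMr // -l1 (bigD1 i) //= lerDl; exact: sumr_ge0.
Qed.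

Lemma sum_cube_le_ypt n (l : 'I_n -> R) (p2 := \sum_i l i ^+ 2) :
  (2 <= n)%N -> \sum_i l i = 1 -> p2 <= 1 ->
  \sum_i l i ^+ 3 <=
    (1 - (n%:R - 1) * ypt n p2) ^+ 3 + (n%:R - 1) * ypt n p2 ^+ 3.
Proof.
move=> n2 l1 p1.
have [|y0 ya E] := ypt_spec n p2 n2; first by rewrite p1 sum_sqr_ge // ltnW.
by apply: sum_cube_le => //; rewrite ?E //; ring.
Qed.

(** For the converse, [sphere_ivt] joins the two extremal vectors [e] and [f], the third point [g]
    being a vertex of the simplex. *)
Lemma power_sumsP n (p2 p3 : R) : (2 <= n)%N ->
  (exists l : 'I_n -> R, [/\ forall i, 0 <= l i, \sum_i l i = 1,
      \sum_i l i ^+ 2 = p2 & \sum_i l i ^+ 3 = p3]) <->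
  [/\ 1 / n%:R <= p2 <= 1,
      p3 <= (1 - (n%:R - 1) * ypt n p2) ^+ 3 + (n%:R - 1) * ypt n p2 ^+ 3
    & alpha p2 * xpt p2 ^+ 3 + (1 - alpha p2 * xpt p2) ^+ 3 <= p3].
Proof.
move=> n2; have n0 := ltnW n2; split=> [[l [l0 l1 <- <-]]|[p2b p3u p3l]].
  have p2b : 1 / n%:R <= \sum_i l i ^+ 2 <= 1.
    by rewrite sum_sqr_ge // sum_sqr_le1.
  split=> //; first by apply: sum_cube_le_ypt => //; case/andP: p2b.
  have [m [m0 aE zx E _]] := xpt_spec n _ n0 p2b.
  rewrite aE; rewrite aE in zx E; apply: sum_cube_ge_ord => //.
  by rewrite addrC subrK.
have [m [/andP[m0 mn] aE zx e2 z0]] := xpt_spec n p2 n0 p2b.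
rewrite aE in p3l zx e2 z0.
have [y0 ya f2] := ypt_spec n p2 n2 p2b.
move: p3l p3u zx e2 z0 y0 ya f2.
set x := xpt p2; set y := ypt n p2; set z := 1 - _ * x.
set a := 1 - _ => p3l p3u /andP[zge zx] e2 z0 y0 ya f2.
have x0 : 0 <= x by lra.
have m1R : 1 <= m%:R :> R by rewrite ler1n.
have n2R : 2 <= n%:R :> R by rewrite ler_nat.
case: n n2 n0 mn p2b z0 @y @a n2R p3u y0 ya f2 => // n _ _.
move=> mn p2b z0 y a n2R p3u y0 ya f2.
have fE k : \sum_(i < n.+1) (if i == ord0 then a else y) ^+ k =
    a ^+ k + (n.+1%:R - 1) * y ^+ k.
  rewrite big_ord_recl eqxx; congr (_ + _).
  under eq_bigr do rewrite eq_sym (negbTE (neq_lift _ _)).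
  rewrite sumr_const card_ord -natr1 addrK mulr_natl //.
pose e (i : 'I_n.+1) := if (i < m)%N then x else if i == m :> nat then z else 0.
have eE k : \sum_i e i ^+ k.+1 = m%:R * x ^+ k.+1 + z ^+ k.+1.
  exact: sum_step_ord.
pose f (i : 'I_n.+1) := if i == ord0 then a else y.
pose g (i : 'I_n.+1) : R := (i == ord0)%:R.
(* Pairing with [g] reads off the first entry, [x] for [e] and [a] for [f]. *)
have sg (h : 'I_n.+1 -> R) : \sum_i h i * g i = h ord0.
  rewrite (bigD1 ord0) //= /g eqxx mulr1 big1 ?addr0 // => i /negbTE ->.
  by rewrite mulr0.
have g1 k : \sum_i g i ^+ k.+1 = 1.
  transitivity (\sum_i (g i ^+ k) * g i).
    by apply: eq_bigr => i _; rewrite exprSr.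
  by rewrite sg /g eqxx expr1n.
have e1 : \sum_i e i = 1.
  by rewrite -sum_expr1 eE !expr1 /z addrC subrK.
have f1 : \sum_i f i = 1.
  by rewrite -sum_expr1 fE !expr1 /a subrK.
apply: (sphere_ivt _ e f g) => //.
- by move=> i; rewrite /e; case: ifP => // _; case: ifP.
- by move=> i; rewrite /f; case: ifP => // _; lra.
- by rewrite -sum_expr1.
- by rewrite eE.
- by rewrite fE.
- by rewrite g1; case/andP: p2b.
- rewrite sg /e m0 -e2.
  have H1 : m%:R * x ^+ 2 + z ^+ 2 = x - z * (x - z) by rewrite /z; ring.
  by rewrite H1 gerBl mulr_ge0 // subr_ge0.
- rewrite sg /f eqxx -f2.
  have -> : a ^+ 2 + (n.+1%:R - 1) * y ^+ 2 = a - (n.+1%:R - 1) * (y * (a - y)).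
    by rewrite /a; ring.
  by rewrite gerBl mulr_ge0 ?[0 <= y * _]mulr_ge0 //; lra.
- by rewrite eE fE p3l.
Qed.

End PowerSums.

(** * Spectral form and positivity of complex matrices *)

Section Quantum.
Local Open Scope complex_scope.
Local Open Scope sesquilinear_scope.

Variable R : realType.
Local Notation C := R[i].

Lemma ctrmxM m n p (A : 'M[C]_(m, n)) (B : 'M[C]_(n, p)) :
  (A *m B) ^t* = B ^t* *m A ^t*.
Proof. by rewrite trmx_mul map_mxM. Qed.

Lemma ctrmx_tens m n p q (A : 'M[C]_(m, n)) (B : 'M[C]_(p, q)) :
  (A *t B) ^t* = A ^t* *t B ^t*.
Proof. by rewrite trmx_tens map_mxT. Qed.

Lemma hermP n (A : 'M[C]_n) : A \is hermsymmx <-> A ^t* = A.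
Proof.
split=> [/is_hermitianmxP|E]; last apply/is_hermitianmxP.
  by rewrite expr0 scale1r => <-.
by rewrite expr0 scale1r E.
Qed.

Lemma psd_gram m n (G : 'M[C]_(m, n)) : psd (G ^t* *m G).
Proof.
split; first by apply/hermP; rewrite ctrmxM trmxCK.
move=> v; have -> : v ^t* *m (G ^t* *m G) *m v = (G *m v) ^t* *m (G *m v).
  by rewrite ctrmxM !mulmxA.
rewrite mxE; apply: sumr_ge0 => i _; rewrite !mxE mulrC; exact: mul_conjC_ge0.
Qed.

Lemma psd_sum n (I : finType) (w : I -> R) (A : I -> 'M[C]_n) :
  (forall i, 0 <= w i) -> (forall i, psd (A i)) ->
  psd (\sum_i (w i)%:C *: A i).
Proof.
move=> w0 pA; split.
  apply/hermP; rewrite linear_sum /= raddf_sum; apply: eq_bigr => i _.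
  rewrite linearZ /= map_mxZ /=; have [/hermP -> _] := pA i.
  congr (_ *: _); apply/CrealP/complex_realP; by exists (w i).
move=> v; rewrite mulmx_sumr mulmx_suml summxE; apply: sumr_ge0 => i _.
rewrite -scalemxAr -scalemxAl mxE mulr_ge0 ?ler0c //; have [_] := pA i; exact.
Qed.

Lemma hermitian_spectral n (A : 'M[C]_n) : A \is hermsymmx ->
  exists2 P : 'M[C]_n, P \is unitarymx &
  exists l : 'I_n -> R, A = P ^t* *m diag_mx (\row_i (l i)%:C) *m P.
Proof.
move=> hA; exists (spectralmx A); first exact: spectral_unitarymx.
exists (fun i => complex.Re (spectral_diag A 0 i)).
have /orthomx_spectralP {1}-> := hermitian_normalmx hA.
rewrite invmx_unitary ?spectral_unitarymx //; congr (_ *m diag_mx _ *m _).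
apply/rowP => i; rewrite mxE RRe_real //.
exact: (mxOverP (hermitian_spectral_diag_real hA)).
Qed.

Lemma diag_mxX n (d : 'rV[C]_n) k :
  diag_mx d ^+ k = diag_mx (\row_i d 0 i ^+ k).
Proof.
elim: k => [|k IHk].
  rewrite expr0; apply/matrixP => i j; rewrite !mxE; congr (_ *+ _).
rewrite exprS IHk -[LHS]/(_ *m _) mul_diag_mx.
apply/matrixP => i j; rewrite !mxE.
by case: eqP => [->|]; rewrite ?mulr1n ?mulr0n ?mulr0 // exprS.
Qed.

Section Spectral.
Variables (n : nat) (P : 'M[C]_n) (l : 'I_n -> R).
Hypothesis uP : P \is unitarymx.
Let A := P ^t* *m diag_mx (\row_i (l i)%:C) *m P.

Lemma trace_spectral k : \tr (A ^+ k) = (\sum_i l i ^+ k)%:C.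
Proof.
have PP : P ^t* *m P = 1%:M.
  by rewrite -invmx_unitary // mulVmx // unitarymx_unit.
have -> : A ^+ k = P ^t* *m (diag_mx (\row_i (l i)%:C)) ^+ k *m P.
  elim: k => [|k IHk]; first by rewrite !expr0 mulmx1 PP.
  rewrite !exprS IHk /A; set D := diag_mx _.
  rewrite -[LHS]/(_ *m _) -[D * _]/(_ *m _) !mulmxA.
  by rewrite -[_ *m P *m P^t*]mulmxA (unitarymxP uP) mulmx1.
rewrite -mulmxA mxtrace_mulC -mulmxA (unitarymxP uP) mulmx1 diag_mxX.
rewrite mxtrace_diag rmorph_sum /=; apply: eq_bigr => i _.
by rewrite !mxE rmorphXn.
Qed.

(** The quadratic form at the eigenvector [P ^t* *m delta_mx i 0] equals [l i]. *)
Lemma psd_spectral_ge0 : psd A -> forall i, 0 <= l i.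
Proof.
move=> [_ H] i; have := H (P ^t* *m delta_mx i 0).
rewrite ctrmxM trmxCK /A !mulmxA -[_ *m P *m P^t*]mulmxA (unitarymxP uP) mulmx1.
rewrite -[_ *m P *m P^t*]mulmxA (unitarymxP uP) mulmx1.
rewrite trmx_delta map_delta_mx -rowE -colE !mxE eqxx mulr1n.
by rewrite ler0c.
Qed.

End Spectral.

(** Converse of [psd_gram]: [G] is the diagonal matrix of square roots of the eigenvalues, times
    [P]. *)
Lemma psd_gramP n (A : 'M[C]_n) : psd A -> exists G : 'M[C]_n, A = G ^t* *m G.
Proof.
move=> pA; have [P uP [l AE]] := hermitian_spectral _ _ pA.1.
have l0 : forall i, 0 <= l i by apply: (psd_spectral_ge0 _ _ _ uP); rewrite -AE.
exists (diag_mx (\row_i (Num.sqrt (l i))%:C) *m P).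
rewrite ctrmxM AE -!mulmxA; congr (_ *m _); rewrite !mulmxA; congr (_ *m _).
apply/matrixP => i j; rewrite tr_diag_mx map_diag_mx mul_diag_mx !mxE.
case: eqP => _; rewrite ?mulr1n ?mulr0n ?mulr0 //.
rewrite -[X in _ = X * _]/(Num.conj _) (CrealP _); last first.
  by apply/complex_realP; exists (Num.sqrt (l i)).
by rewrite -rmorphM -expr2 sqr_sqrtr.
Qed.

(** If [A = G ^t* *m G], then [A^T] is the Gram matrix of the conjugate of [G], and a tensor product
    of Gram matrices is again one. *)
Lemma psd_trmx_tens m n (A : 'M[C]_m) (B : 'M[C]_n) :
  psd A -> psd B -> psd (A^T *t B).
Proof.
move=> /psd_gramP[G ->] /psd_gramP[H ->]; rewrite trmx_mul.
have -> : (G ^t*)^T = map_mx Num.conj G.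
  by apply/matrixP => i j; rewrite !mxE.
have -> : G^T = (map_mx Num.conj G) ^t*.
  by apply/matrixP => i j; rewrite !mxE conjCK.
by rewrite -tensmx_mul -ctrmx_tens; exact: psd_gram.
Qed.

Lemma psd_delta n (i : 'I_n) : psd (delta_mx i i : 'M[C]_n).
Proof.
have -> : delta_mx i i = (delta_mx 0 i : 'rV[C]_n) ^t* *m delta_mx 0 i.
  by rewrite trmx_delta map_delta_mx mul_delta_mx.
exact: psd_gram.
Qed.

Lemma quantum_state_delta n (i : 'I_n) : quantum_state (delta_mx i i : 'M[C]_n).
Proof.
split; first exact: psd_delta.
rewrite -(mul_delta_mx (0 : 'I_1)) mxtrace_mulC mul_delta_mx.
by rewrite /mxtrace big_ord1 mxE.
Qed.

(** * Moments of the partial transpose *)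

Section PartialTranspose.
Variables dA dB : nat.
Implicit Types rho : 'M[C]_(dA * dB).

Lemma ptranspose_hermsymmx rho :
  rho \is hermsymmx -> ptransposeA rho \is hermsymmx.
Proof.
move=> /hermP rhoE; apply/hermP; apply/matrixP => i j.
by rewrite !mxE -[in RHS]rhoE !mxE.
Qed.

Lemma mxtrace_ptranspose rho : \tr (ptransposeA rho) = \tr rho.
Proof.
by apply: eq_bigr => i _; rewrite mxE -!surjective_pairing mxtens_unindexK.
Qed.

Lemma mxtrace_sqr n (M : 'M[C]_n) :
  \tr (M ^+ 2) = \sum_(ij : 'I_n * 'I_n) M ij.1 ij.2 * M ij.2 ij.1.
Proof.
rewrite expr2 -[M * M]/(M *m M) /mxtrace.
rewrite -(pair_bigA _ (fun i j => M i j * M j i)) /=.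
by apply: eq_bigr => i _; rewrite mxE.
Qed.

(** Partial transposition only permutes the terms [M i j * M j i] of the trace, through the
    involution [h] on index pairs. *)
Lemma mxtrace_ptranspose_sqr rho :
  \tr (ptransposeA rho ^+ 2) = \tr (rho ^+ 2).
Proof.
rewrite !mxtrace_sqr.
pose h (ij : 'I_(dA * dB) * 'I_(dA * dB)) :=
  (mxtens_index ((mxtens_unindex ij.2).1, (mxtens_unindex ij.1).2),
   mxtens_index ((mxtens_unindex ij.1).1, (mxtens_unindex ij.2).2)).
have hK : involutive h.
  case=> i j; case: (mxtens_indexP i) => a b; case: (mxtens_indexP j) => a2 b2.
  by rewrite /h !mxtens_indexK.
rewrite [RHS](reindex_inj (inv_inj hK)); apply: eq_bigr => -[i j] _.
by rewrite !mxE.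
Qed.

Lemma ptranspose_sum_tens (I : finType) (w : I -> C)
    (sA : I -> 'M[C]_dA) (sB : I -> 'M[C]_dB) :
  ptransposeA (\sum_k w k *: (sA k *t sB k)) =
  \sum_k w k *: ((sA k)^T *t sB k).
Proof.
apply/matrixP => i j; rewrite mxE !summxE; apply: eq_bigr => k _.
by rewrite -ptransposeA_tens !mxE.
Qed.

(** The Peres criterion: each product term becomes [(sA k)^T *t sB k], which is still positive
    semidefinite. *)
Lemma separable_ptranspose_psd rho :
  separable_state rho -> psd (ptransposeA rho).
Proof.
move=> [_ [m [w [sA [sB [w0 _ qA qB ->]]]]]]; rewrite ptranspose_sum_tens.
apply: psd_sum => // k; apply: psd_trmx_tens.
  by case: (qA k).
by case: (qB k).
Qed.

(** [l] is the spectrum of the partial transpose; its sign is made conditional so that entangled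
    states are covered too. *)
Lemma pt_moment_spectral rho : rho \is hermsymmx ->
  exists2 l : 'I_(dA * dB) -> R,
    forall k, pt_moment rho k = (\sum_i l i ^+ k)%:C &
    psd (ptransposeA rho) -> forall i, 0 <= l i.
Proof.
move=> /ptranspose_hermsymmx/hermitian_spectral[P uP [l E]].
exists l => [k|]; first by rewrite /pt_moment E trace_spectral.
by rewrite E; exact: psd_spectral_ge0.
Qed.

Lemma quantum_state_spectral rho (p1 p2 p3 : R) :
  quantum_state rho -> has_pt_moments rho p1 p2 p3 ->
  exists l : 'I_(dA * dB) -> R,
    [/\ p1 = 1, \sum_i l i = 1, \sum_i l i ^+ 2 = p2, \sum_i l i ^+ 3 = p3 &
    psd (ptransposeA rho) -> forall i, 0 <= l i].
Proof.
move=> [[hrho _] trho] [m1 m2 m3].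
have [l lE l0] := pt_moment_spectral _ hrho; exists l.
have p11 : p1 = 1.
  by apply: (@complexI R); rewrite m1 /pt_moment expr1 mxtrace_ptranspose trho.
split=> //; apply: (@complexI R); rewrite ?m2 ?m3 ?lE //.
by rewrite -[RHS]/(1%:C) -[in RHS]p11 m1 lE sum_expr1.
Qed.

(** The second moment equals the purity, so the nonnegative spectrum of [rho] itself replaces that
    of the partial transpose. *)
Lemma pt_moment2_le1 rho (p1 p2 p3 : R) :
  quantum_state rho -> has_pt_moments rho p1 p2 p3 -> p2 <= 1.
Proof.
move=> [prho trho] [_ m2 _].
have [P uP [l E]] := hermitian_spectral _ _ prho.1.
have -> : p2 = \sum_i l i ^+ 2.
  apply: (@complexI R).
  by rewrite m2 /pt_moment mxtrace_ptranspose_sqr E trace_spectral.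
apply: sum_sqr_le1; first by apply: (psd_spectral_ge0 _ _ _ uP); rewrite -E.
have := trace_spectral _ _ l uP 1; rewrite -E expr1 trho sum_expr1.
by move=> /(@complexI R _ _) ->.
Qed.

(** The entries of [l] are the weights of a mixture of product basis projectors, each fixed by the
    partial transpose. *)
Lemma diag_separable (l : 'I_(dA * dB) -> R) :
  (forall i, 0 <= l i) -> \sum_i l i = 1 ->
  exists2 rho : 'M[C]_(dA * dB), separable_state rho &
    forall k, pt_moment rho k = (\sum_i l i ^+ k)%:C.
Proof.
move=> l0 l1.
have dE : diag_mx (\row_i (l i)%:C) = \sum_k (l k)%:C *:
    (delta_mx (mxtens_unindex k).1 (mxtens_unindex k).1 *t
     delta_mx (mxtens_unindex k).2 (mxtens_unindex k).2) :> 'M[C]_(dA * dB).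
  rewrite diag_mx_sum_delta; apply: eq_bigr => k _; rewrite mxE; congr (_ *: _).
  have E a b : (a == b :> 'I_(dA * dB)) =
      ((mxtens_unindex a).1 == (mxtens_unindex b).1) &&
      ((mxtens_unindex a).2 == (mxtens_unindex b).2).
    by rewrite -(can_eq (@mxtens_unindexK dA dB)).
  by apply/matrixP => i j; rewrite !mxE !E -natrM mulnb andbACA.
have trE k : \tr (diag_mx (\row_i (l i)%:C) ^+ k) = (\sum_i l i ^+ k)%:C.
  rewrite diag_mxX mxtrace_diag rmorph_sum /=; apply: eq_bigr => i _.
  by rewrite !mxE rmorphXn.
exists (diag_mx (\row_i (l i)%:C)) => [|k]; last first.
  rewrite /pt_moment -trE dE ptranspose_sum_tens; congr (\tr (_ ^+ k)).
  by apply: eq_bigr => i _; rewrite trmx_delta.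
split; last first.
  exists (dA * dB)%N, l,
    (fun k => delta_mx (mxtens_unindex k).1 (mxtens_unindex k).1),
    (fun k => delta_mx (mxtens_unindex k).2 (mxtens_unindex k).2).
  by split=> // k; exact: quantum_state_delta.
split; last first.
  by have := trE 1%N; rewrite expr1 => ->; rewrite sum_expr1 l1.
rewrite dE; apply: psd_sum => // k; rewrite -[X in X *t _]trmx_delta.
by apply: psd_trmx_tens; exact: psd_delta.
Qed.

Lemma separable_pt_momentsP (p1 p2 p3 : R) :
  (exists rho : 'M[C]_(dA * dB),
    separable_state rho /\ has_pt_moments rho p1 p2 p3) <->
  p1 = 1 /\ exists l : 'I_(dA * dB) -> R, [/\ forall i, 0 <= l i,
    \sum_i l i = 1, \sum_i l i ^+ 2 = p2 & \sum_i l i ^+ 3 = p3].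
Proof.
split=> [[rho [srho mrho]]|[-> [l [l0 l1 l2 l3]]]].
  have [l [p11 l1 l2 l3 l0]] := quantum_state_spectral _ _ _ _ srho.1 mrho.
  split=> //; exists l; split=> //; apply: l0.
  exact: separable_ptranspose_psd.
have [rho srho rhoE] := diag_separable l l0 l1; exists rho; split=> //.
by split; rewrite rhoE -?l1 -?l2 -?l3.
Qed.

End PartialTranspose.
End Quantum.

Theorem theorem3 (R : realType) (dA dB : nat) (hd : (2 <= dA * dB)%N) :
  let d := (dA * dB)%N in
  (forall p1 p2 p3 : R,
     (exists rho : 'M[R[i]]_(dA * dB),
        separable_state rho /\ has_pt_moments rho p1 p2 p3)
     <->
     [/\ p1 = 1,
         1 / d%:R <= p2 <= 1,
         p3 <= (1 - (d%:R - 1) * ypt d p2) ^+ 3 + (d%:R - 1) * ypt d p2 ^+ 3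
       & alpha p2 * xpt p2 ^+ 3 + (1 - alpha p2 * xpt p2) ^+ 3 <= p3])
  /\
  (forall p1 p2 p3 : R,
     (exists rho : 'M[R[i]]_(dA * dB),
        quantum_state rho /\ has_pt_moments rho p1 p2 p3) ->
     ((exists rho : 'M[R[i]]_(dA * dB),
         separable_state rho /\ has_pt_moments rho p1 p2 p3)
      <->
      alpha p2 * xpt p2 ^+ 3 + (1 - alpha p2 * xpt p2) ^+ 3 <= p3)).
Proof.
move=> d.
have sepP (p1 p2 p3 : R) : (exists rho : 'M[R[i]]_(dA * dB),
      separable_state rho /\ has_pt_moments rho p1 p2 p3) <->
    [/\ p1 = 1, 1 / d%:R <= p2 <= 1,
      p3 <= (1 - (d%:R - 1) * ypt d p2) ^+ 3 + (d%:R - 1) * ypt d p2 ^+ 3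
    & alpha p2 * xpt p2 ^+ 3 + (1 - alpha p2 * xpt p2) ^+ 3 <= p3].
  apply: (iff_trans (separable_pt_momentsP _ _ _ _ _ _)).
  by split=> [[-> /power_sumsP[]]|[-> ? ? ?]] //; split=> //; apply/power_sumsP.
split=> [//|p1 p2 p3 [rho [qrho mrho]]]; split=> [/sepP[]//|lower].
(* The purity gives [p2 <= 1]; with it, the two other conditions hold for any real vector of sum
   one. *)
have p2u : p2 <= 1 by exact: pt_moment2_le1 qrho mrho.
have [l [p11 l1 l2 l3 _]] := quantum_state_spectral _ _ _ _ _ _ _ qrho mrho.
apply/sepP; split=> //.
  by rewrite p2u -l2 sum_sqr_ge // ltnW.
by rewrite -l3 -l2; apply: sum_cube_le_ypt; rewrite ?l2.
Qed.
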